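(* Let $p\ge 1$, $q\ge 1$, $m>1$, $n\ge \max\{m,3\}$ be integers, let $S=\{0,1,\ldots,m-1\}$, and let $\varphi:S^p\to S^q$ be a partial function. Then there exists a graph $G_{\varphi,n}[\mathbf{x};\mathbf{y};R]$ that simulates $\varphi$ through $n$-colorings. Moreover, if $\Theta$ denotes the number of transpositions in a presentation of an $(m,p+q,s_0)$-invertible extension of $\varphi$ as a product of transpositions of $S^{p+q}$, then $$|V(G_{\varphi,n})| = O\big(\Theta\,(p+q)\, n^{2(p+q)+4}\big)\quad\text{and}\quad |E(G_{\varphi,n})| = O\big(\Theta\,(p+q)\, n^{3(p+q)+5}\big).$$
   Context: All graphs are finite and simple. Let $S=\{0,\ldots,m-1\}$ (symbols) and $C=\{0,\ldots,n-1\}$ (colors). An $n$-coloring of a graph $G$ is a map $\sigma:V(G)\to C$ with $\sigma(u)\ne\sigma(v)$ for every edge $uv$. A partial function $\varphi:S^p\to S^q$ may be undefined on some elements of $S^p$; its domain is the set of elements at which it is defined. Simulation: a graph $G$ with specified vertices $X=\{x_0,\ldots,x_{p-1}\}$ (inputs), $Y=\{y_0,\ldots,y_{q-1}\}$ (outputs) and $R=\{\tilde 0,\tilde 1,\ldots,\widetilde{n-1}\}$ (references), written $G[\mathbf{x};\mathbf{y};R]$, simulates $\varphi$ through $n$-colorings if: (i) $G$ is $n$-colorable and $X\cup Y\cup R\subseteq V(G)$; (ii) in every $n$-coloring of $G$ the vertices of $R$ take pairwise different colors (so one may normalize to $\sigma(\tilde i)=i$); (iii) every assignment $\sigma_0:X\cup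 R\to C$ with $\sigma_0(\tilde i)=i$ for all $0\le i<n$ has an extension to an $n$-coloring $\sigma$ of $G$ if and only if $(\sigma_0(x_0),\ldots,\sigma_0(x_{p-1}))$ is in the domain of $\varphi$, in which case the extension $\sigma$ is unique and $\varphi(\sigma(x_0),\ldots,\sigma(x_{p-1}))=(\sigma(y_0),\ldots,\sigma(y_{q-1}))$. For $s_0\in S$, an $(m,p+q,s_0)$-invertible extension of $\varphi$ is a bijection $\tilde\varphi:S^{p+q}\to S^{p+q}$ such that for each $\mathbf{x}$ in the domain of $\varphi$ one has $\tilde\varphi(\mathbf{x},s_0,\ldots,s_0)=(\varphi(\mathbf{x}),\mathbf{y}_{\mathbf{x}})$ for some vector $\mathbf{y}_{\mathbf{x}}\in S^{p}$. The implied constants in $O(\cdot)$ are absolute, and $\Theta\ge1$.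
   Formalization: The partial function φ is assumed to be defined on at least one element of S^p; for the nowhere-defined φ no graph can satisfy conditions (i)–(iii), since a normalized n-coloring would put its input vector in the empty domain. *)

(* Defs.v *)
From HB Require Import structures.
From mathcomp Require Import all_boot all_fingroup.

Set Implicit Arguments.
Unset Strict Implicit.
Unset Printing Implicit Defensive.

Record sgraph := SGraph {
  vertex :> finType;
  adj : rel vertex;
  adj_sym : symmetric adj;
  adj_irr : irreflexive adj
}.

Definition edges (G : sgraph) : {set {set G}} :=
  [set [set uv.1; uv.2] | uv : G * G & adj uv.1 uv.2].

Definition coloring (G : sgraph) (n : nat) (sigma : G -> 'I_n) : Prop :=
  forall u v : G, adj u v -> sigma u <> sigma v.

(* S^k is [k.-tuple 'I_m] and a partial function S^p -> S^q is a function into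
   [option], with [None] for "undefined".  Since symbols have type ['I_m] and
   colors type ['I_n], vectors of either kind are compared through their
   sequences of natural number values. *)
Definition values (n : nat) (s : seq 'I_n) : seq nat := [seq val i | i <- s].

Definition partial_fun (m p q : nat) : Type :=
  p.-tuple 'I_m -> option (q.-tuple 'I_m).

Definition in_domain (m p q : nat) (phi : partial_fun m p q) (a : seq nat) :
    Prop :=
  exists2 s : p.-tuple 'I_m, phi s <> None & values s = a.

Definition maps_to (m p q : nat) (phi : partial_fun m p q) (a b : seq nat) :
    Prop :=
  exists (s : p.-tuple 'I_m) (t : q.-tuple 'I_m),
    [/\ phi s = Some t, values s = a & values t = b].

(* An assignment on X \cup R is a function on all of G of which only the
   values on X \cup R are used. *)
Definition extends (G : sgraph) (n : nat) (D : seq G) (sigma0 sigma : G -> 'I_n)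
    : Prop :=
  coloring sigma /\ {in D, sigma =1 sigma0}.

(* The listed inputs are distinct vertices and none of them is a reference,
   so that the input colors can be assigned freely; outputs may be inputs or
   references.  Distinctness of the references follows from the first two of
   the coloring conditions.  Those conditions also force phi to be defined
   somewhere: a coloring of G, with its colors permuted so that the i-th
   reference gets color i, extends its own restriction to X \cup R. *)
Definition simulates (m p q n : nat) (phi : partial_fun m p q) (G : sgraph)
    (x : p.-tuple G) (y : q.-tuple G) (r : n.-tuple G) : Prop :=
  [/\ [/\ uniq x, uniq y & [disjoint x & r]],
      exists sigma : G -> 'I_n, coloring sigma,
      forall sigma : G -> 'I_n, coloring sigma ->
        injective (fun i : 'I_n => sigma (tnth r i)) &
      forall sigma0 : G -> 'I_n, (forall i : 'I_n, sigma0 (tnth r i) = i) ->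
        ((exists sigma : G -> 'I_n, extends (x ++ r) sigma0 sigma) <->
           in_domain phi (values (map sigma0 x)))
        /\ (forall sigma : G -> 'I_n, extends (x ++ r) sigma0 sigma ->
             (forall sigma' : G -> 'I_n,
                extends (x ++ r) sigma0 sigma' -> sigma' =1 sigma)
             /\ maps_to phi (values (map sigma x)) (values (map sigma y)))].

Definition invertible_extension (m p q : nat) (s0 : 'I_m)
    (phi : partial_fun m p q) (phi' : {perm (p + q).-tuple 'I_m}) : Prop :=
  forall (s : p.-tuple 'I_m) (t : q.-tuple 'I_m), phi s = Some t ->
    exists z : p.-tuple 'I_m,
      phi' [tuple of s ++ nseq q s0] = t ++ z :> seq 'I_m.

Definition transposition_presentation (T : finType) (f : {perm T})
    (ts : seq (T * T)) : Prop :=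
  all dpair ts /\ f = (\prod_(t <- ts) tperm t.1 t.2)%g.

(* Main.v *)
(* A list coloring problem becomes an n-coloring problem once a clique of n
   reference vertices is added, a vertex being adjacent to the references whose
   colors its list excludes. Starting from the p + q isolated input and output
   vertices, for each of the at most n ^ (p + q) color vectors outside the graph
   of phi we attach a gadget of size O((p + q) n) that excludes exactly this
   vector, and whose own coloring is determined by the colors of the inputs and
   outputs. The gadget scans the coordinates with an AND vertex per coordinate.
   Its size does not depend on Theta, as O((p + q) n ^ (p + q + 1)) vertices
   and the square of this for the edges fit the bounds already for Theta = 1. *)

Require Import Defs.
From HB Require Import structures.
From Stdlib Require Import FunctionalExtensionality.
From mathcomp Require Import all_boot all_fingroup.
From mathcomp Require Import zify.

Set Implicit Arguments.
Unset Strict Implicit.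
Unset Printing Implicit Defensive.

(** * List coloring problems and their uniquely solvable extensions *)

Record system (n : nat) := System {
  var :> finType;
  conflict : rel var;
  allowed : var -> pred 'I_n
}.

Definition solution n (S : system n) (f : S -> 'I_n) : Prop :=
  (forall u v, conflict u v -> f u != f v) /\ forall v, allowed v (f v).

(** Restriction along [h] is a bijection from the solutions of [S'] onto the solutions of [S] that
    satisfy [Q]: thus [Q] is the net constraint imposed by at most [k] new variables. *)
Record extension n (S S' : system n) (h : S -> S') (Q : (S -> 'I_n) -> Prop)
    (k : nat) : Prop := Extension {
  ext_inj : injective h;
  ext_card : #|S'| <= #|S| + k;
  ext_restrict : forall f, solution f -> solution (f \o h) /\ Q (f \o h);
  ext_extend : forall f, solution f -> Q f ->
    exists2 f', solution f' & f' \o h = f;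
  ext_unique : forall f1 f2 : S' -> 'I_n, solution f1 -> solution f2 ->
    f1 \o h = f2 \o h -> f1 = f2
}.

Definition always n (S : system n) (_ : S -> 'I_n) : Prop := True.

Lemma extension_refl n (S : system n) : extension id (@always n S) 0.
Proof.
split=> //; last by move=> f f_sol _; exists f.
by rewrite addn0.
Qed.

(** [Q'] speaks of solutions of [S2], so it is transported to [S1] by quantifying over the
    extensions of [f]; there is at most one, and [Q f] provides it. *)
Lemma extension_trans n (S1 S2 S3 : system n) (h : S1 -> S2) (h' : S2 -> S3)
    (Q : (S1 -> 'I_n) -> Prop) Q' k k' :
  extension h Q k -> extension h' Q' k' ->
  extension (h' \o h)
    (fun f => Q f /\ forall f', solution f' -> f' \o h = f -> Q' f') (k + k').
Proof.
move=> [hI hC hR hE hU] [hI' hC' hR' hE' hU']; split.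
- exact: inj_comp.
- by rewrite addnA (leq_trans hC') ?leq_add2r.
- move=> f /hR' [f_sol Qf]; have [f_sol1 Qf1] := hR _ f_sol.
  split=> //; split=> // f' f'_sol eq_f.
  by rewrite (hU f' (f \o h')).
- move=> f f_sol [Qf Q'f]; have [f1 f1_sol def_f] := hE f f_sol Qf.
  have [f2 f2_sol def_f1] := hE' f1 f1_sol (Q'f f1 f1_sol def_f).
  by exists f2 => //; rewrite -def_f -def_f1.
move=> f1 f2 sol1 sol2 eq12; apply: hU' => //; apply: hU => //.
  exact: (proj1 (hR' _ sol1)).
exact: (proj1 (hR' _ sol2)).
Qed.

Lemma extension_weaken n (S S' : system n) (h : S -> S') Q Q' k k' :
  extension h Q k -> (forall f, solution f -> Q f <-> Q' f) -> k <= k' ->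
  extension h Q' k'.
Proof.
move=> [hI hC hR hE hU] QQ' le_k; split=> //.
- by rewrite (leq_trans hC) ?leq_add2l.
- by move=> f /hR [f_sol Qf]; split=> //; apply/QQ'.
by move=> f f_sol Qf; apply: hE => //; apply/QQ'.
Qed.

(** * Attaching a block of new variables *)

Section Block.

Variables (n : nat) (S : system n) (W : finType).
Variables (eW : rel W) (eSW : S -> pred W) (LW : W -> pred 'I_n).

(** Conflicts between old and new variables are recorded in one direction only; [list_adj]
    symmetrizes them. *)
Definition block_conflict (u v : S + W) : bool :=
  match u, v with
  | inl x, inl y => conflict x y
  | inl x, inr w => eSW x w
  | inr w, inr w' => eW w w'
  | inr _, inl _ => false
  end.

Definition block_allowed (u : S + W) : pred 'I_n :=
  match u with inl x => allowed x | inr w => LW w end.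

Definition block : system n := System block_conflict block_allowed.

Definition glue (f : S -> 'I_n) (g : W -> 'I_n) (u : S + W) : 'I_n :=
  match u with inl x => f x | inr w => g w end.

Definition block_solution (f : S -> 'I_n) (g : W -> 'I_n) : Prop :=
  [/\ forall w w', eW w w' -> g w != g w',
      forall x w, eSW x w -> f x != g w & forall w, LW w (g w)].

Lemma solution_block (f : block -> 'I_n) :
  solution f <->
  solution (fun x : S => f (inl x)) /\
  block_solution (fun x => f (inl x)) (fun w => f (inr w)).
Proof.
split=> [[fC fL] | [[fC fL] [gC fg gL]]].
  split; first split=> [x y xy | x].
  - exact: (fC (inl x) (inl y)).
  - exact: (fL (inl x)).
  split=> [w w' ww' | x w xw | w]; last exact: (fL (inr w)).
    exact: (fC (inr w) (inr w')).
  exact: (fC (inl x) (inr w)).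
split; last by case.
by case=> [x|w] [y|w'] //=; [apply: fC | apply: fg | apply: gC].
Qed.

(** A solution of the block is a pair of colorings, old and new, so a gadget is verified by solving
    its local constraints for a fixed old coloring [f]. *)
Lemma block_extension (Q : (S -> 'I_n) -> Prop) (G : (S -> 'I_n) -> W -> 'I_n) :
  (forall f g, solution f -> block_solution f g <-> Q f /\ g =1 G f) ->
  extension (inl : S -> block) Q #|W| /\
  forall f : block -> 'I_n, solution f -> forall w, f (inr w) = G (f \o inl) w.
Proof.
move=> det; have val (f : block -> 'I_n) : solution f ->
    forall w, f (inr w) = G (f \o inl) w.
  by move=> /solution_block [f_sol /(det _ _ f_sol) []].
split=> //; split.
- by move=> x y [].
- by rewrite /= card_sum.
- by move=> f /solution_block [f_sol /(det _ _ f_sol) [Qf _]].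
- move=> f f_sol Qf; exists (glue f (G f)) => //.
  by apply/solution_block; split=> //; apply/det.
move=> f1 f2 sol1 sol2 eq12; apply: functional_extensionality.
case=> [x|w]; first exact: (congr1 (fun f => f x) eq12).
by rewrite !val // eq12.
Qed.

End Block.

(** * Gadgets that test and forbid color patterns *)

Section Gadgets.

Variable n : nat.
Implicit Types (S : system n).

(* The vertices [u_j], [j != d], with lists [{j, d}], form a clique with [v]:
   the one with [j] the color of [v], if any, must take [d], and then no other
   one can. The vertex [u_d] is isolated. *)
Lemma switch_gadget S (v : S) (c d : 'I_n) : c != d ->
  exists (S' : system n) (h : S -> S') (w : S'), extension h (@always n S) n /\
    forall f : S' -> 'I_n, solution f -> f w = if f (h v) == c then d else c.
Proof.
move=> neq_cd.
pose eW (i j : 'I_n) := [&& i != j, i != d & j != d].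
pose eSW (x : S) (j : 'I_n) := (x == v) && (j != d).
pose LW (j : 'I_n) := pred2 j d.
pose G (f : S -> 'I_n) (j : 'I_n) := if f v == j then d else j.
have [|ext val] := @block_extension n S _ eW eSW LW (@always n S) G; last first.
  exists (block eW eSW LW), inl, (inr c); split; first by rewrite card_ord in ext.
  by move=> f f_sol; rewrite val.
move=> f g _; split=> [[gC fg gL] | [_ def_g]]; last first.
  split=> [i j /and3P [ij id jd] | x j /andP [/eqP -> jd] | j].
  - rewrite !def_g /G; case: (eqVneq (f v) i) => [->|_].
      by rewrite (negPf ij) eq_sym.
    by case: ifP; rewrite ?(eq_sym d).
  - by rewrite def_g /G; case: (eqVneq (f v) j) => [->|].
  by rewrite def_g /G /LW /=; case: ifP; rewrite eqxx ?orbT.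
split=> // j; rewrite /G.
have gv i : i != d -> f v != g i by move=> id; apply: fg; rewrite /eSW eqxx.
have gE i : (g i == i) || (g i == d) := gL i.
have [->{j}|jd] := eqVneq j d.
  by rewrite if_same; have := gE d; rewrite orbb => /eqP.
case: eqVneq => [vj|vj].
  by have := gE j; rewrite eq_sym -{1}vj (negPf (gv j jd)) => /eqP.
(* Suppose that [u_j] takes [d]. If [v] has color [d], it clashes with [u_j]; otherwise the vertex
   indexed by the color of [v] takes [d] too, against the clique. *)
have [/eqP // | /eqP gjd] := orP (gE j).
have [vd|vd] := eqVneq (f v) d; first by have := gv j jd; rewrite vd gjd eqxx.
have /eqP gvd : g (f v) == d.
  by have := gE (f v); rewrite eq_sym (negPf (gv _ vd)).
by have := gC (f v) j; rewrite gvd gjd eqxx /eW vj vd jd => /(_ isT).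
Qed.

(* A switch from [c] to [b] followed by one from [b] to [a] turns [c] into [b]
   and then [a], every other color into [c] and then [b]. *)
Lemma indicator_gadget S (v : S) (c a b : 'I_n) : a != b ->
  exists (S' : system n) (h : S -> S') (w : S'),
    extension h (@always n S) (2 * n) /\
    forall f : S' -> 'I_n, solution f -> f w = if f (h v) == c then a else b.
Proof.
move=> neq_ab; have [->|neq_bc] := eqVneq c b.
  (* For [c = b] one switch suffices: it turns [b] into [a] and everything else into [b]. *)
  have [|S1 [h1 [w1 [ext1 val1]]]] := @switch_gadget S v b a; first by rewrite eq_sym.
  by exists S1, h1, w1; split=> //; apply: extension_weaken ext1 _ _ => //; lia.
have [S1 [h1 [w1 [ext1 val1]]]] := switch_gadget v neq_bc.
have [|S2 [h2 [w2 [ext2 val2]]]] := @switch_gadget S1 w1 b a; first by rewrite eq_sym.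
exists S2, (h2 \o h1), w2; split.
  by apply: extension_weaken (extension_trans ext1 ext2) _ _ => //; lia.
move=> f f_sol; rewrite val2 // [f (h2 w1)](val1 (f \o h2)) /=; last first.
  by case: (ext_restrict ext2 f_sol).
by case: (f (h2 (h1 v)) == c); rewrite ?eqxx // (negPf neq_bc).
Qed.

Variables a b g : 'I_n.
Hypotheses (neq_ab : a != b) (neq_ag : a != g) (neq_bg : b != g).

(* The new vertex has the list [{a, b, g}] and is adjacent to three indicators.
   If [t] is not colored [g], those of [t] take [g] and [b] and leave only [a];
   if it is, both take [a], and the indicator of [v = c] chooses between [b]
   and [g]. *)
Lemma and_gadget S (t v : S) (c : 'I_n) :
  exists (S' : system n) (h : S -> S') (w : S'),
    extension h (@always n S) (6 * n).+1 /\
    forall f : S' -> 'I_n, solution f ->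
      (f w == g) = (f (h t) == g) && (f (h v) == c).
Proof.
(* This indicator takes only the colors [b] and [g], so it never blocks [a]. *)
have [S1 [h1 [x [ext1 val1]]]] := indicator_gadget v c neq_bg.
have [S2 [h2 [y [ext2 val2]]]] := indicator_gadget (h1 t) g neq_ag.
have [S3 [h3 [z [ext3 val3]]]] := indicator_gadget (h2 (h1 t)) g neq_ab.
pose h := h3 \o (h2 \o h1).
have sol2 f : solution f -> solution (f \o h3) by case/(ext_restrict ext3).
have sol1 f : solution f -> solution (f \o (h3 \o h2)).
  by move=> /sol2 /(ext_restrict ext2) [].
pose eSW (u : S3) (_ : unit) := u \in [:: h3 (h2 x); h3 y; z].
pose LW (_ : unit) := [pred i | i \in [:: a; b; g]].
pose G (f : S3 -> 'I_n) (_ : unit) :=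
  if f (h t) == g then if f (h v) == c then g else b else a.
have [|ext val] :=
  @block_extension n S3 _ (fun _ _ => false) eSW LW (@always n S3) G; last first.
  exists (block (fun _ _ => false) eSW LW), (inl \o h), (inr tt); split.
    have /extension_trans/(_ ext) := extension_trans ext1 (extension_trans ext2 ext3).
    by move/extension_weaken; apply=> //; rewrite card_unit; lia.
  move=> f f_sol; rewrite val // /G /=.
  by case: (f (inl (h t)) == g); case: (f (inl (h v)) == c);
    rewrite ?eqxx ?(negPf neq_ag) ?(negPf neq_bg).
move=> f k f_sol.
have {}val1 : f (h3 (h2 x)) = if f (h v) == c then b else g := val1 _ (sol1 _ f_sol).
have {}val2 : f (h3 y) = if f (h t) == g then a else g := val2 _ (sol2 _ f_sol).
have {}val3 : f z = if f (h t) == g then a else b := val3 _ f_sol.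
have mem_adj w : eSW w tt = (w \in [:: h3 (h2 x); h3 y; z]) by [].
have neqs := (negPf neq_ab, negPf neq_ag, negPf neq_bg).
have {}neqs : ((b == a = false) * (g == a = false) * (g == b = false) *
    (a == b = false) * (a == g = false) * (b == g = false))%type.
  by rewrite !neqs ![_ == a]eq_sym [g == b]eq_sym !neqs.
split=> [[_ fk kL] | [_ def_k]]; last first.
  split=> [//|w [] | []]; last first.
    rewrite def_k /G /LW !inE.
    by case: (f (h t) == g); case: (f (h v) == c); rewrite eqxx ?orbT.
  rewrite mem_adj !inE def_k /G => /or3P[]/eqP->; rewrite ?val1 ?val2 ?val3;
    by case: (f (h t) == g); case: (f (h v) == c); rewrite neqs.
split=> // -[].
have nx : f (h3 (h2 x)) != k tt by apply: fk; rewrite mem_adj inE eqxx.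
have ny : f (h3 y) != k tt by apply: fk; rewrite mem_adj !inE eqxx orbT.
have nz : f z != k tt by apply: fk; rewrite mem_adj !inE eqxx !orbT.
have := kL tt; rewrite /LW /G !inE; move: nx ny nz; rewrite val1 val2 val3.
by case: (f (h t) == g); case: (f (h v) == c); 
  move=> nx ny nz /or3P[]/eqP def_k //; move: nx ny nz; rewrite def_k eqxx.
Qed.

Definition matches (T : Type) (f : T -> 'I_n) (ps : seq (T * 'I_n)) : bool :=
  all (fun vc => f vc.1 == vc.2) ps.

(** The color [g] stands for truth: a vertex with list [{g}] handles the empty pattern, and each
    further pair costs one AND gadget. *)
Lemma match_gadget S (ps : seq (S * 'I_n)) :
  exists (S' : system n) (h : S -> S') (w : S'),
    extension h (@always n S) (size ps * (6 * n).+1).+1 /\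
    forall f : S' -> 'I_n, solution f -> (f w == g) = matches (f \o h) ps.
Proof.
elim: ps => [|[v c] ps [S1 [h1 [w1 [ext1 val1]]]]].
  have [|ext val] := @block_extension n S unit (fun _ _ => false)
    (fun _ _ => false) (fun _ => pred1 g) (@always n S) (fun _ _ => g).
    move=> f k _; split=> [[_ _ kL] | [_ kE]].
      by split=> // w; apply/eqP/kL.
    by split=> // w /=; rewrite kE.
  exists (@block n S unit (fun _ _ => false) (fun _ _ => false) (fun _ => pred1 g)).
  exists inl, (inr tt); split; first by rewrite card_unit in ext.
  by move=> f f_sol; rewrite val // eqxx.
have [S2 [h2 [w2 [ext2 val2]]]] := and_gadget w1 (h1 v) c.
exists S2, (h2 \o h1), w2; split.
  apply: extension_weaken (extension_trans ext1 ext2) _ _ => //=.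
  by rewrite mulSn; lia.
move=> f f_sol; rewrite val2 // andbC; congr (_ && _).
by apply: (val1 (f \o h2)); case: (ext_restrict ext2 f_sol).
Qed.

(** A vertex with list [{g}] attached to the output of the match gadget bars that output from being
    true. *)
Lemma forbid_gadget S (ps : seq (S * 'I_n)) :
  exists (S' : system n) (h : S -> S'),
    extension h (fun f => ~~ matches f ps) (size ps * (6 * n).+1).+2.
Proof.
have [S1 [h1 [w1 [ext1 val1]]]] := match_gadget ps.
have [|ext2 _] := @block_extension n S1 unit (fun _ _ => false)
    (fun x _ => x == w1) (fun _ => pred1 g)
    (fun f => ~~ matches (f \o h1) ps) (fun _ _ => g).
  move=> f k f_sol; rewrite -val1 //; split=> [[_ fk kL] | [nm kE]].
    split=> [|w]; last exact/eqP/kL.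
    by have := fk w1 tt (eqxx _); rewrite (eqP (kL tt)).
  by split=> [//|x w /eqP->|w] /=; rewrite kE.
exists (@block n S1 unit (fun _ _ => false) (fun x _ => x == w1) (fun _ => pred1 g)).
exists (fun x => inl (h1 x)); apply: extension_weaken (extension_trans ext1 ext2) _ _.
  move=> f f_sol; split=> [[_ Qf] | nm].
    (* The match gadget extends every solution, so the condition on extensions is not vacuous. *)
    by have [f' f'_sol eq_f] := ext_extend ext1 f_sol I; rewrite -eq_f; apply: Qf.
  by split=> // f' _ ->.
by rewrite card_unit; lia.
Qed.

Lemma forbid_all_gadget S (d : nat) (pss : seq (seq (S * 'I_n))) :
  all (fun ps => size ps == d) pss ->
  exists (S' : system n) (h : S -> S'),
    extension h (fun f => ~~ has (matches f) pss)
      (size pss * (d * (6 * n).+1).+2).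
Proof.
elim: pss => [|ps pss IH] /=.
  move=> _; exists S, id; apply: extension_weaken (extension_refl S) _ _ => //.
case/andP=> /eqP sz_ps /IH [S1 [h1 ext1]].
(* The next gadget is attached to the already extended system, so its pattern is moved along
   [h1]. *)
have [S2 [h2 ext2]] := forbid_gadget [seq (h1 vc.1, vc.2) | vc <- ps].
exists S2, (h2 \o h1).
apply: extension_weaken (extension_trans ext1 ext2) _ _; last first.
  by rewrite size_map sz_ps mulSn; lia.
move=> f f_sol; rewrite negb_or.
have matches_map f' : matches f' [seq (h1 vc.1, vc.2) | vc <- ps] = matches (f' \o h1) ps.
  by rewrite /matches all_map.
split=> [[nm Qf] | /andP [nm nms]].
  rewrite nm andbT; have [f' f'_sol def_f] := ext_extend ext1 f_sol nm.
  by rewrite -def_f -matches_map; apply: Qf.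
by split=> // f' _ def_f; rewrite matches_map def_f.
Qed.

(** Starting from unconstrained variables indexed by [T], each vector outside [A] is forbidden by
    the pattern listing all its coordinates; there are at most [n ^ #|T|] of them. *)
Lemma relation_system (T : finType) (A : pred {ffun T -> 'I_n}) :
  exists (S : system n) (h : T -> S),
  [/\ injective h,
      #|S| <= #|T| + n ^ #|T| * (#|T| * (6 * n).+1).+2,
      forall f : S -> 'I_n, solution f -> A (finfun (f \o h)),
      forall k : {ffun T -> 'I_n}, A k ->
        exists2 f : S -> 'I_n, solution f & f \o h =1 k &
      forall f1 f2 : S -> 'I_n, solution f1 -> solution f2 ->
        f1 \o h =1 f2 \o h -> f1 =1 f2].
Proof.
pose S0 := @System n T (fun _ _ => false) (fun _ _ => true).
pose clause (k : {ffun T -> 'I_n}) : seq (S0 * 'I_n) := [seq (t, k t) | t <- enum T].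
pose pss := [seq clause k | k <- enum (predC A)].
have [|S [h ext]] := @forbid_all_gadget S0 #|T| pss.
  by apply/allP => _ /mapP [k _ ->]; rewrite size_map -cardE.
have match_clause (f : S0 -> 'I_n) k : matches f (clause k) = (finfun f == k).
  rewrite /matches all_map; apply/allP/eqP => [fk | <- t _]; last by rewrite /= ffunE.
  by apply/ffunP => t; rewrite ffunE; apply/eqP/fk; rewrite mem_enum.
have bad (f : S0 -> 'I_n) : ~~ has (matches f) pss = A (finfun f).
  apply/hasPn/idP => [nm | Af _ /mapP [k kA ->]].
    apply/negPn/negP => nAf; have in_pss : clause (finfun f) \in pss.
      by apply: map_f; rewrite mem_enum.
    by have := nm _ in_pss; rewrite match_clause eqxx.
  by rewrite match_clause; apply: contraTneq Af => ->; rewrite mem_enum in kA.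
exists S, h; split.
- exact: ext_inj ext.
- apply: leq_trans (ext_card ext) _; rewrite leq_add2l leq_mul2r size_map -cardE.
  by rewrite (leq_trans (max_card _)) ?orbT // card_ffun card_ord.
- by move=> f /(ext_restrict ext) [_]; rewrite bad.
- move=> k Ak; have [||f f_sol fk] := @ext_extend _ _ _ _ _ _ ext (k : S0 -> 'I_n).
  + by split.
  + by rewrite bad; congr A: Ak; apply/ffunP => t; rewrite ffunE.
  + by exists f => // t; rewrite fk.
move=> f1 f2 sol1 sol2 eq12; suff -> : f1 = f2 by [].
by apply: (ext_unique ext) => //; apply: functional_extensionality.
Qed.

End Gadgets.

(** * From list colorings to graph colorings *)

Section ListGraph.

Variables (n : nat) (S : system n).

Definition list_adj (u v : S + 'I_n) : bool :=
  match u, v with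
  | inl x, inl y => (x != y) && (conflict x y || conflict y x)
  | inl x, inr i | inr i, inl x => ~~ allowed x i
  | inr i, inr j => i != j
  end.

Lemma list_adj_sym : symmetric list_adj.
Proof. by case=> [x|i] [y|j] //=; rewrite eq_sym // orbC. Qed.

Lemma list_adj_irr : irreflexive list_adj.
Proof. by case=> [x|i] /=; rewrite eqxx. Qed.

Definition list_graph : sgraph := SGraph list_adj_sym list_adj_irr.

(** The graph drops conflicts of a variable with itself; the existence of a solution shows that
    there are none. *)
Lemma coloring_list_graph (f : list_graph -> 'I_n) :
  (exists f0 : S -> 'I_n, solution f0) -> (forall i, f (inr i) = i) ->
  coloring f <-> solution (fun x : S => f (inl x)).
Proof.
move=> [f0 [f0C _]] f_ref; split=> [f_col | [fC fL]].
  split=> [x y xy | x].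
    have neq_xy : x != y.
      by apply/eqP=> eq_xy; move/eqP: (f0C x y xy); rewrite eq_xy.
    by apply/eqP/f_col; rewrite /= neq_xy xy.
  by apply/negPn/negP => /(f_col (inl x) (inr _)); rewrite f_ref.
case=> [x|i] [y|j] /=; rewrite ?f_ref.
- by case/andP=> _ /orP[] /fC /eqP // + /esym.
- by move=> nL fx; case/negP: nL; rewrite -fx.
- by move=> nL fx; case/negP: nL; rewrite fx.
by move/eqP.
Qed.

Lemma coloring_references (f : list_graph -> 'I_n) :
  coloring f -> injective (fun i => f (inr i)).
Proof.
move=> f_col i j eq_f; apply/eqP/negPn/negP => neq_ij.
exact: (f_col (inr i) (inr j) neq_ij).
Qed.

End ListGraph.

(** * Edge count, and the partial function as a relation on colors *)

Lemma card_edges_leq (G : sgraph) : #|edges G| <= #|G| ^ 2.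
Proof.
by rewrite (leq_trans (leq_imset_card _ _)) // (leq_trans (max_card _)) // card_prod.
Qed.

Lemma eq_values_codom (m n p : nat) (f : 'I_p -> 'I_n) (s : p.-tuple 'I_m) :
  reflect (values s = values [seq f i | i <- enum 'I_p])
    [forall i, val (f i) == tnth s i].
Proof.
rewrite /values -(map_tnth_enum s) -!map_comp.
apply: (iffP forallP) => [eq_fs | /eq_in_map eq_fs i].
  by apply: eq_map => i /=; rewrite (eqP (eq_fs i)).
by rewrite -[val _]eq_fs ?mem_enum.
Qed.

(** A boolean form of [maps_to], so that the vectors violating it can be enumerated. *)
Definition graph_pred (m p q n : nat) (phi : partial_fun m p q) :
    pred {ffun 'I_p + 'I_q -> 'I_n} :=
  fun k => [exists s, if phi s is Some t then
    [forall i, val (k (inl i)) == tnth s i] &&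
    [forall j, val (k (inr j)) == tnth t j] else false].

Lemma graph_predP (m p q n : nat) (phi : partial_fun m p q)
    (k : {ffun 'I_p + 'I_q -> 'I_n}) :
  reflect (maps_to phi (values [seq k (inl i) | i <- enum 'I_p])
                       (values [seq k (inr j) | j <- enum 'I_q]))
    (graph_pred phi k).
Proof.
apply: (iffP existsP) => [[s] | [s [t [phi_s eq_s eq_t]]]].
  case phi_s: (phi s) => [t|//] /andP [/eq_values_codom eq_s /eq_values_codom eq_t].
  by exists s, t.
by exists s; rewrite phi_s; apply/andP; split; apply/eq_values_codom.
Qed.

Lemma maps_to_fun (m p q : nat) (phi : partial_fun m p q) a b b' :
  maps_to phi a b -> maps_to phi a b' -> b = b'.
Proof.
move=> [s [t [phi_s <- <-]]] [s' [t' [+ eq_s <-]]].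
have -> : s' = s by apply/val_inj/(inj_map val_inj).
by rewrite phi_s => -[->].
Qed.

Lemma values_inj (n p : nat) (f f' : 'I_p -> 'I_n) :
  values [seq f i | i <- enum 'I_p] = values [seq f' i | i <- enum 'I_p] ->
  f =1 f'.
Proof.
by move=> /(inj_map val_inj) /eq_in_map eq_f i; apply: eq_f; rewrite mem_enum.
Qed.

(** * The simulation property *)

Lemma list_graph_simulates (m p q n : nat) (phi : partial_fun m p q)
    (S : system n) (h : 'I_p + 'I_q -> S) :
  m <= n -> (exists s, phi s <> None) -> injective h ->
  (forall f : S -> 'I_n, solution f -> graph_pred phi (finfun (f \o h))) ->
  (forall k, graph_pred phi k -> exists2 f : S -> 'I_n, solution f & f \o h =1 k) ->
  (forall f1 f2 : S -> 'I_n, solution f1 -> solution f2 ->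
     f1 \o h =1 f2 \o h -> f1 =1 f2) ->
  @simulates m p q n phi (list_graph S) [tuple inl (h (inl i)) | i < p]
    [tuple inl (h (inr j)) | j < q] [tuple inr i | i < n].
Proof.
move=> le_mn [s0 phi_s0] hI hR hE hU.
(* Inputs that spell an element of the domain are completed by giving the outputs the symbols of its
   image, read as colors since [m <= n]. *)
have lift (s : p.-tuple 'I_m) t (k : 'I_p -> 'I_n) : phi s = Some t ->
    values s = values [seq k i | i <- enum 'I_p] ->
  exists2 f : S -> 'I_n, solution f & forall i, f (h (inl i)) = k i.
  move=> phi_s eq_s.
  pose k' := [ffun u =>
    match u with inl i => k i | inr j => widen_ord le_mn (tnth t j) end].
  have [|f f_sol fk] := hE k'; last first.
    by exists f => // i; have := fk (inl i); rewrite /= ffunE.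
  apply/existsP; exists s; rewrite phi_s; apply/andP; split; last first.
    by apply/forallP => j; rewrite ffunE.
  by move/eq_values_codom/forallP: eq_s => eq_s; apply/forallP => i; rewrite ffunE.
have ex_sol : exists f : S -> 'I_n, solution f.
  case phi_s: (phi s0) phi_s0 => [t|//] _.
  have [|f f_sol _] := lift s0 t (fun i => widen_ord le_mn (tnth s0 i)) phi_s.
    by apply/eq_values_codom/forallP => i.
  by exists f.
pose x : p.-tuple (list_graph S) := [tuple inl (h (inl i)) | i < p].
pose y : q.-tuple (list_graph S) := [tuple inl (h (inr j)) | j < q].
pose r : n.-tuple (list_graph S) := [tuple inr i | i < n].
have colP (f : list_graph S -> 'I_n) : (forall i, f (inr i) = i) ->
    coloring f <-> solution (fun u : S => f (inl u)) :=
  coloring_list_graph ex_sol.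
have map_x (f : list_graph S -> 'I_n) : map f x
    = [seq f (inl (h (inl i))) | i <- enum 'I_p] by rewrite -map_comp.
have map_y (f : list_graph S -> 'I_n) : map f y
    = [seq f (inl (h (inr j))) | j <- enum 'I_q] by rewrite -map_comp.
have mapsP (f : S -> 'I_n) : solution f ->
  maps_to phi (values [seq f (h (inl i)) | i <- enum 'I_p])
    (values [seq f (h (inr j)) | j <- enum 'I_q]).
  move=> /hR /graph_predP.
  under eq_map do rewrite ffunE /=.
  by under [X in maps_to _ _ (values X)]eq_map do rewrite ffunE /=.
split.
- split; try by rewrite map_inj_uniq ?enum_uniq // => i j [/hI []].
  rewrite disjoint_has; apply/hasPn => _ /mapP [i _ ->].
  by apply/mapP => -[].
- have [f f_sol] := ex_sol.
  pose f' (u : list_graph S) := match u with inl v => f v | inr i => i end.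
  by exists f'; apply/colP.
- move=> f f_col i j; rewrite !tnth_mktuple; exact: coloring_references.
move=> f0 f0_ref.
have {}f0_ref i : f0 (inr i) = i by have := f0_ref i; rewrite tnth_mktuple.
have extP (f : list_graph S -> 'I_n) : extends (x ++ r) f0 f ->
    [/\ forall i : 'I_n, f (inr i) = i, solution (fun u : S => f (inl u)) &
      forall i, f (inl (h (inl i))) = f0 (inl (h (inl i)))].
  move=> [f_col eq_f].
  have f_ref i : f (inr i) = i.
    by rewrite eq_f ?f0_ref // mem_cat orbC map_f ?mem_enum.
  split=> //; first exact/colP.
  by move=> i; rewrite eq_f // mem_cat (map_f (fun i => inl (h (inl i)))) ?mem_enum.
split; first split.
- move=> [f /extP [f_ref f_sol eq_f]]; have [s [t [phi_s eq_s _]]] := mapsP _ f_sol.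
  exists s; first by rewrite phi_s.
  by rewrite eq_s map_x; congr values; apply: eq_map.
- move=> [s + eq_s]; case phi_s: (phi s) => [t|//] _.
  have [|f f_sol fk] := lift s t (fun i => f0 (inl (h (inl i)))) phi_s.
    by rewrite eq_s map_x.
  pose f' (u : list_graph S) := match u with inl v => f v | inr i => i end.
  exists f'; split; first by apply/colP.
  by move=> u; rewrite mem_cat => /orP[] /mapP [i _ ->] /=; rewrite ?fk ?f0_ref.
move=> f /extP [f_ref f_sol eq_f]; split; last first.
  by rewrite map_x map_y; exact: (mapsP _ f_sol).
move=> f' /extP [f'_ref f'_sol eq_f'] [v|i]; last by rewrite f_ref f'_ref.
apply: (hU _ _ f'_sol f_sol) => -[i|j] /=; first by rewrite eq_f eq_f'.
(* Both extensions have the prescribed inputs, so they agree on the outputs because [phi] is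
   single-valued. *)
have eq_x : [seq f' (inl (h (inl i))) | i <- enum 'I_p]
  = [seq f (inl (h (inl i))) | i <- enum 'I_p].
  by apply: eq_map => i; rewrite eq_f eq_f'.
have := mapsP _ f'_sol; rewrite eq_x => f'_maps.
exact: (values_inj (maps_to_fun f'_maps (mapsP _ f_sol)) j).
Qed.

(** * Existence and size of the simulating graph *)

Theorem theorem1 :
  exists KV KE : nat,
  forall (p q m n : nat) (hp : 1 <= p) (hq : 1 <= q) (hm : 1 < m)
    (hn : maxn m 3 <= n) (phi : partial_fun m p q)
    (hphi : exists s : p.-tuple 'I_m, phi s <> None),
  exists (G : sgraph) (x : p.-tuple G) (y : q.-tuple G) (r : n.-tuple G),
    simulates phi x y r /\
    (forall (s0 : 'I_m) (phi' : {perm (p + q).-tuple 'I_m})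
       (ts : seq ((p + q).-tuple 'I_m * (p + q).-tuple 'I_m)),
       invertible_extension s0 phi phi' ->
       transposition_presentation phi' ts ->
       1 <= size ts ->
       #|G| <= KV * (size ts * (p + q) * n ^ (2 * (p + q) + 4)) /\
       #|edges G| <= KE * (size ts * (p + q) * n ^ (3 * (p + q) + 5))).
Proof.
exists 10, 100 => p q m n hp hq hm hn phi hphi.
have [le_mn n_ge3] : m <= n /\ 3 <= n by move: hn; rewrite geq_max => /andP.
have n_gt0 : 0 < n by apply: leq_trans n_ge3.
have n_gt1 : 1 < n by apply: leq_trans n_ge3.
(* The colors 0, 1 and 2 serve as [a], [b] and [g]. *)
have [|||S [h [hI hC hR hE hU]]] :=
  @relation_system n (Ordinal n_gt0) (Ordinal n_gt1) (Ordinal n_ge3) _ _ _ _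
    (@graph_pred m p q n phi); try by [].
exists (list_graph S), [tuple inl (h (inl i)) | i < p],
  [tuple inl (h (inr j)) | j < q], [tuple inr i | i < n].
split; first exact: list_graph_simulates.
move=> _ _ ts _ _ ts_gt0; set k := p + q.
have k_ge2 : 2 <= k by rewrite /k; lia.
(* The leading term is [6 * k * n ^ k.+1]; the lower terms and the [n] references fit in the
   slack. *)
have cardG : #|list_graph S| <= 10 * (k * n ^ k.+1).
  rewrite card_sum card_ord; rewrite card_sum !card_ord -/k in hC.
  apply: leq_trans (leq_add hC (leqnn n)) _.
  have := expn_gt0 n k; rewrite n_gt0 expnS; set N := n ^ k => /= N_gt0.
  nia.
split.
  apply: leq_trans cardG _; rewrite leq_mul2l -mulnA /=.
  rewrite -[leqLHS]mul1n leq_mul // leq_mul2l leq_exp2l //.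
  by apply/orP; right; lia.
apply: leq_trans (card_edges_leq _) _.
have /leq_trans-> // : #|list_graph S| ^ 2 <= (10 * (k * n ^ k.+1)) ^ 2.
  by rewrite leq_sqr.
have -> : (10 * (k * n ^ k.+1)) ^ 2 = 100 * (k * (k * n ^ (2 * k).+2)).
  by rewrite !expnMn -expnM; have -> : k.+1 * 2 = (2 * k).+2; lia.
rewrite leq_mul2l -mulnA /= -[leqLHS]mul1n leq_mul // leq_mul2l; apply/orP; right.
(* Squaring the vertex bound leaves a second factor [k], absorbed by [n ^ k]; the remaining [n ^ 3]
   is at least 1. *)
have -> : 3 * k + 5 = k + (2 * k).+2 + 3 by lia.
rewrite 2![n ^ (_ + _)]expnD -[leqLHS]muln1 leq_mul ?expn_gt0 ?n_gt0 // leq_mul2r.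
by rewrite (ltnW (ltn_expl _ _)) ?orbT.
Qed.
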